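(* For $n$ large, there exists a family of $2^{\lfloor n/7\rfloor}$ non-isomorphic, mutually cospectral graphs with respect to the normalized Laplacian.
   Context: All graphs are finite, simple and undirected. The normalized Laplacian of a graph is $\mathcal{L}=D^{-1/2}(D-\mathrm{Adj})D^{-1/2}$, where $\mathrm{Adj}$ is the adjacency matrix and $D$ is the diagonal matrix of degrees; by convention an isolated vertex contributes an eigenvalue $0$. Graphs are mutually cospectral with respect to a matrix if the associated matrices all have the same eigenvalues with the same multiplicities. ''Non-isomorphic'' means pairwise non-isomorphic. *)

(* Defs.v *)
From mathcomp Require Import all_boot all_order all_algebra.

Set Implicit Arguments.
Unset Strict Implicit.
Unset Printing Implicit Defensive.

Import Order.TTheory GRing.Theory Num.Theory.
Local Open Scope ring_scope.

Record sgraph (n : nat) := SGraph {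
  adj : rel 'I_n;
  adj_sym : symmetric adj;
  adj_irr : irreflexive adj
}.

Definition isomorphic (n : nat) (G H : sgraph n) : Prop :=
  exists2 f : 'I_n -> 'I_n,
    bijective f & forall x y, adj H (f x) (f y) = adj G x y.

Definition degree (n : nat) (G : sgraph n) (x : 'I_n) : nat :=
  #|[set y | adj G x y]|.

Definition adj_mx (R : rcfType) (n : nat) (G : sgraph n) : 'M[R]_n :=
  \matrix_(i, j) (adj G i j)%:R.

Definition degree_mx (R : rcfType) (n : nat) (G : sgraph n) : 'M[R]_n :=
  diag_mx (\row_i (degree G i)%:R).

(* D^{-1/2}. Since 0^-1 = 0, an isolated vertex gives a zero row and column of
   the normalized Laplacian, hence contributes the eigenvalue 0. *)
Definition degree_mx_inv_sqrt (R : rcfType) (n : nat) (G : sgraph n) :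
    'M[R]_n :=
  diag_mx (\row_i (Num.sqrt (degree G i)%:R)^-1).

Definition normalized_laplacian (R : rcfType) (n : nat) (G : sgraph n) :
    'M[R]_n :=
  degree_mx_inv_sqrt R G *m (degree_mx R G - adj_mx R G)
    *m degree_mx_inv_sqrt R G.

(* Same eigenvalues with the same algebraic multiplicities. Only eigenvalues
   in R are compared, which is all of them when A and B are symmetric. *)
Definition cospectral (R : rcfType) (n : nat) (A B : 'M[R]_n) : Prop :=
  forall a : R, mup a (char_poly A) = mup a (char_poly B).

(* Main.v *)
(** Godsil-McKay switching. If a set of vertices splits into independent cells of
    c vertices and every outside vertex is adjacent to 0, c/2 or c vertices of
    each cell, then complementing the half-adjacent pairs conjugates the
    adjacency matrix by the involution equal to (2/c)J - I on each cell. This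
    involution commutes with the degree matrix when degrees are unchanged and
    constant on cells, so the normalized Laplacian keeps its spectrum.

    With b = n %/ 7, take for each bit j < b a cell of four independent blocks,
    joined to the four even triples of {x_j, X'} x {Y, Y'} x {Z, Z'} or to the
    four odd ones, according to the bit; the points X', Y, Y', Z, Z' are shared
    by all bits. Flipping a bit is a switching. This costs 5b + 5 vertices; the
    remaining ones are pads, joined to points so as to give all points distinct
    degrees, larger than those of the other vertices. An isomorphism thus fixes
    every point, and the bits can be read off from common neighbours of points. *)

Require Import Defs.
From mathcomp Require Import all_boot all_order all_algebra.
From mathcomp Require Import reals ring zify.

Set Implicit Arguments.
Unset Strict Implicit.
Unset Printing Implicit Defensive.

Import Order.TTheory GRing.Theory Num.Theory.
Local Open Scope ring_scope.

(** * Godsil-McKay switching for the normalized Laplacian *)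

Lemma char_poly_simmx (F : fieldType) (n : nat) (P A B : 'M[F]_n) :
  P \in unitmx -> B *m P = P *m A -> char_poly A = char_poly B.
Proof.
rewrite unitmxE unitfE => P_neq0 simAB.
have: map_mx polyC P *m char_poly_mx A = char_poly_mx B *m map_mx polyC P.
  by rewrite /char_poly_mx mulmxBr mulmxBl scalar_mxC -!map_mxM simAB.
move/(congr1 determinant); rewrite !det_mulmx mulrC => /mulIf; apply.
by rewrite det_map_mx polyC_eq0.
Qed.

Section Switching.

Variables (R : rcfType) (n : nat) (I : eqType) (cell : 'I_n -> option I).

Local Notation cell_of x := [set z | cell z == cell x].

(** [None] marks the vertices outside all cells, where the matrix is the identity. *)
Definition switch_mx : 'M[R]_n := \matrix_(x, y)
  ((isSome (cell x) && (cell y == cell x))%:R * (2 / #|cell_of x|%:R)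
   + (-1) ^+ isSome (cell x) * (x == y)%:R).

Lemma card_cell_neq0 x : #|cell_of x|%:R != 0 :> R.
Proof. by rewrite pnatr_eq0 -lt0n; apply/card_gt0P; exists x; rewrite inE. Qed.

Lemma sum_switch_mx x (F : 'I_n -> R) : \sum_z switch_mx x z * F z =
  if cell x then 2 / #|cell_of x|%:R * (\sum_(z | cell z == cell x) F z) - F x
  else F x.
Proof.
rewrite (eq_bigr (fun z => (if isSome (cell x) && (cell z == cell x) then
    2 / #|cell_of x|%:R * F z else 0)
    + if z == x then (-1) ^+ isSome (cell x) * F x else 0)); last first.
  move=> z _; rewrite mxE mulrDl (eq_sym x).
  by case: (z =P x) => [->|_]; case: (_ && _); rewrite ?(mulr1, mulr0, mul1r, mul0r).
rewrite big_split /= -!big_mkcond big_pred1_eq /=.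
case: (cell x) => [i|] /=; last by rewrite big_pred0_eq add0r mul1r.
by rewrite mulN1r mulr_sumr.
Qed.

Lemma switch_mx_sym : switch_mx^T = switch_mx.
Proof.
apply/matrixP => x y; rewrite !mxE (eq_sym y x).
have [->//|/eqP neq_xy] := eqVneq x y; rewrite !mulr0 !addr0.
rewrite (eq_sym (cell x)); case: eqP => [->//|_].
by rewrite !andbF !mul0r.
Qed.

(** On a cell of size c, J^2 = cJ, hence ((2/c)J - I)^2 = (4/c)J - (4/c)J + I = I. *)
Lemma switch_mxK : switch_mx *m switch_mx = 1%:M.
Proof.
apply/matrixP => x y; rewrite !mxE sum_switch_mx.
case Ex: (cell x) => [i|] /=; last by rewrite mxE Ex /= mul0r add0r mul1r.
rewrite -switch_mx_sym; under eq_bigr do rewrite mxE.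
have [Exy|Nxy] := eqVneq (cell y) (Some i); last first.
  rewrite big1 => [|z /eqP Ez].
    rewrite mulr0 sub0r -switch_mx_sym !mxE Ex.
    by rewrite (negbTE Nxy) mul0r add0r mulN1r opprK.
  rewrite mxE Ez (eq_sym (Some i)) (negbTE Nxy) andbF mul0r add0r.
  by case: (y =P z) Ez Nxy => [->->|_ _ _]; rewrite ?eqxx // mulr0.
rewrite -Ex [X in _ * X](eq_bigr (fun z =>
  2 / #|cell_of x|%:R + (if z == y then -1 else 0))); last first.
  move=> z /eqP Ez; rewrite mxE Ez Exy Ex eqxx /= mul1r mulN1r (eq_sym y).
  by case: (z =P y) => _; rewrite ?mulr1 ?mulr0 ?oppr0.
rewrite big_split /= sumr_const -big_mkcondr /=.
rewrite (big_pred1 y) => [|z]; last first.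
  by rewrite /= andbC; case: eqP => //= ->; rewrite Exy Ex eqxx.
have -> : #|[pred z | cell z == cell x]| = #|cell_of x|.
  by rewrite -cardsE; apply: eq_card => z; rewrite !inE.
rewrite switch_mx_sym mxE Exy Ex eqxx /= mul1r mulN1r.
have := card_cell_neq0 x; rewrite Ex; set c := #|_| => c_neq0.
by rewrite -[_ / _ *+ c]mulr_natr divfK //; ring.
Qed.

Lemma switch_mx_unit : switch_mx \in unitmx.
Proof. by case: (mulmx1_unit switch_mxK). Qed.

Lemma switch_diag_mx (d : 'I_n -> R) :
  (forall x y, cell x -> cell x = cell y -> d x = d y) ->
  diag_mx (\row_i d i) *m switch_mx = switch_mx *m diag_mx (\row_i d i).
Proof.
move=> dP; apply/matrixP => x y; rewrite mul_diag_mx mul_mx_diag !mxE mulrC.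
have [->//|_] := eqVneq x y; rewrite mulr0 addr0.
case Ex: (cell x) => [i|] /=; last by rewrite !mul0r.
case: eqP => Ey; last by rewrite !mul0r.
by rewrite (dP x y) ?Ex.
Qed.

Section Graphs.

Variables G H : sgraph n.

Hypothesis cell_indep : forall x y, cell x -> cell y ->
  adj G x y = false /\ adj H x y = false.
Hypothesis adj_outside : forall x y, ~~ cell x -> ~~ cell y ->
  adj H x y = adj G x y.
(** Division-free switching condition: it forces the sum to be 0, c/2 or c, and [H] to complement
    [G] exactly in the half case. *)
Hypothesis adj_switch : forall x y, cell x -> ~~ cell y ->
  (#|cell_of x| * (adj G x y + adj H x y) =
   2 * \sum_(z | cell z == cell x) adj G z y)%N.
Hypothesis degree_switch : degree H =1 degree G.
Hypothesis degree_cell : forall x y, cell x -> cell x = cell y ->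
  degree G x = degree G y.

(** Summing [adj_switch] over the cell gives s + s' = 2s. This makes [adj_switch] symmetric in [G]
    and [H]. *)
Lemma switch_sum_adj x y : cell x -> ~~ cell y ->
  (\sum_(z | cell z == cell x) adj H z y =
   \sum_(z | cell z == cell x) adj G z y)%N.
Proof.
move=> Cx Cy; set s := (RHS).
have card_gt0 : (0 < #|cell_of x|)%N by rewrite lt0n -(pnatr_eq0 R) card_cell_neq0.
have: (\sum_(z | cell z == cell x) #|cell_of x| * (adj G z y + adj H z y)
       = #|cell_of x| * (2 * s))%N.
  rewrite (eq_bigr (fun=> (2 * s)%N)) => [|z /eqP Ez].
    by rewrite sum_nat_const -cardsE.
  by have := @adj_switch z y; rewrite Ez; apply.
rewrite -big_distrr big_split /= -/s => /eqP.
rewrite eqn_pmul2l // mul2n -addnn eqn_add2l => /eqP //.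
Qed.

Lemma switch_adj_mx : adj_mx R H *m switch_mx = switch_mx *m adj_mx R G.
Proof.
have switchE (K K' : sgraph n) x y : cell x -> ~~ cell y ->
    (#|cell_of x| * (adj K x y + adj K' x y) =
      2 * \sum_(z | cell z == cell x) adj K z y)%N ->
    2 / #|cell_of x|%:R * (\sum_(z | cell z == cell x) (adj K z y)%:R)
      - (adj K x y)%:R = (adj K' x y)%:R :> R.
  move=> Cx Cy /(congr1 (fun k => k%:R : R)); rewrite !natrM natrD natr_sum.
  move=> E; apply/(mulfI (card_cell_neq0 x)); rewrite mulrBr.
  by rewrite mulrA mulrCA divff ?card_cell_neq0 // mulr1 -E; ring.
(* Transposing the left side puts [switch_mx] in front there too, so that [sum_switch_mx] expands
   both sides. *)
rewrite -[LHS]trmxK trmx_mul switch_mx_sym.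
have -> : (adj_mx R H)^T = adj_mx R H.
  by apply/matrixP => x y; rewrite !mxE adj_sym.
apply/matrixP => x y; rewrite !mxE !sum_switch_mx !mxE.
under eq_bigr do rewrite mxE; under [in RHS]eq_bigr do rewrite mxE.
case: ifPn => Cy; case: ifPn => Cx.
- rewrite !big1 => [|z /eqP Ez|z /eqP Ez].
  + by rewrite (proj2 (cell_indep Cy Cx)) (proj1 (cell_indep Cx Cy)) !mulr0.
  + by rewrite (proj1 (cell_indep _ Cy)) // Ez.
  + by rewrite (proj2 (cell_indep _ Cx)) // Ez.
- rewrite (switchE H G) //; first by rewrite adj_sym.
  by rewrite switch_sum_adj // addnC adj_switch.
- by rewrite (switchE G H) // ?adj_switch // adj_sym.
- by rewrite adj_outside // adj_sym.
Qed.

Lemma switch_cospectral :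
  cospectral (normalized_laplacian R G) (normalized_laplacian R H).
Proof.
move=> a; congr (mup _ _); apply: (char_poly_simmx switch_mx_unit).
have EH : normalized_laplacian R H =
    degree_mx_inv_sqrt R G *m (degree_mx R G - adj_mx R H)
      *m degree_mx_inv_sqrt R G.
  rewrite /normalized_laplacian /degree_mx /degree_mx_inv_sqrt.
  by congr (diag_mx _ *m (diag_mx _ - _) *m diag_mx _);
    apply/rowP => i; rewrite !mxE degree_switch.
have degC := switch_diag_mx (fun x y Cx Exy =>
  congr1 (fun k => k%:R : R) (degree_cell Cx Exy)).
have sqrtC := switch_diag_mx (fun x y Cx Exy =>
  congr1 (fun k => (Num.sqrt (k%:R : R))^-1) (degree_cell Cx Exy)).
rewrite EH /normalized_laplacian /degree_mx /degree_mx_inv_sqrt.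
rewrite -[LHS]mulmxA sqrtC mulmxA -(mulmxA (diag_mx _)) mulmxBl degC.
by rewrite switch_adj_mx -mulmxBr !mulmxA sqrtC.
Qed.

End Graphs.

End Switching.

Lemma sum_nat_bool (T : finType) (P : pred T) : (\sum_x P x = #|[pred x | P x]|)%N.
Proof.
by rewrite -sum1_card [RHS]big_mkcond; apply: eq_bigr => x _; rewrite /= inE; case: (P x).
Qed.

Lemma isomorphic_sym (n : nat) (G H : sgraph n) :
  isomorphic G H -> isomorphic H G.
Proof.
case=> f [f' fK f'K] f_adj; exists f'; first by exists f.
by move=> x y; rewrite -f_adj !f'K.
Qed.

Lemma degree_iso (n : nat) (G H : sgraph n) (f : 'I_n -> 'I_n) x :
  bijective f -> (forall x y, adj H (f x) (f y) = adj G x y) ->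
  degree H (f x) = degree G x.
Proof.
move=> f_bij f_adj; rewrite /degree -(on_card_preimset (f := f)).
  by apply: eq_card => y; rewrite !inE f_adj.
exact: onW_bij.
Qed.

(** * Block graphs: degrees and recovery of the bits *)

Section Construction.

Variables (b m : nat).
Hypothesis pads_enough : (b + 5 <= m)%N.

Local Notation block := ('I_b * (bool * bool))%type.
Local Notation point := ('I_b + 'I_5)%type.
Local Notation vertex := (block + (point + 'I_m))%type.

(* [inl j] is x_j and [inr 0], ..., [inr 4] are X', Y, Y', Z, Z'. *)
Definition rank (p : point) : nat :=
  match p with inl a => a | inr t => (b + t)%N end.

(* For the bit [w = false], the block [(j, (s, t))] contains x_j iff [s], Y iff [t]
   and Z iff [s (+) t]; the bit [true] complements it. *)
Definition incident (w : bool) (B : block) (p : point) : bool :=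
  let: (j, (s, t)) := B in
  match p with
  | inl a => (a == j) && (s (+) w)
  | inr k => nth false [:: ~~ s; t; ~~ t; s (+) t; ~~ (s (+) t)] k (+) w
  end.

(** Making the points a clique adds [b + 4] to their degrees, which lifts them above those of the
    pads. *)
Definition vertex_adj (w : {ffun 'I_b -> bool}) (u v : vertex) : bool :=
  match u, v with
  | inl B, inr (inl p) | inr (inl p), inl B => incident (w B.1) B p
  | inr (inl p), inr (inl q) => p != q
  | inr (inl p), inr (inr i) | inr (inr i), inr (inl p) => (i <= rank p)%N
  | _, _ => false
  end.

(** Independent of the bits. A block takes one point from each of three pairs; a point lies in two
    blocks of each cell that it meets, [x_j] meeting one cell and a shared point all [b]. *)
Definition vertex_degree (v : vertex) : nat :=
  match v with
  | inl _ => 3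
  | inr (inl p) =>
    ((if p is inl _ then 2 else 2 * b) + ((b + 4) + (rank p).+1))%N
  | inr (inr i) => (\sum_p (i <= rank p))%N
  end.

Lemma vertex_adj_sym w : symmetric (vertex_adj w).
Proof. by move=> [B|[p|i]] [B'|[q|i']] //=; rewrite eq_sym. Qed.

Lemma vertex_adj_irr w : irreflexive (vertex_adj w).
Proof. by move=> [B|[p|i]] //=; rewrite eqxx. Qed.

Lemma rank_lt p : (rank p < b + 5)%N.
Proof. by case: p => a /=; have := ltn_ord a; lia. Qed.

Lemma rank_inj : injective rank.
Proof.
move=> [a|t] [a'|t'] /= E.
- by congr inl; apply: val_inj.
- by have := ltn_ord a; lia.
- by have := ltn_ord a'; lia.
- by congr inr; apply: val_inj => /=; lia.
Qed.

Lemma sum_bool2 (F : bool * bool -> nat) :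
  (\sum_c F c = F (true, true) + F (true, false)
                + (F (false, true) + F (false, false)))%N.
Proof.
rewrite (eq_bigr (fun c => F (c.1, c.2))) => [|[]//].
by rewrite -(pair_bigA _ (fun s t => F (s, t))) /= !big_bool.
Qed.

(** The value 2 is half of the four blocks of a cell, as switching requires. *)
Lemma sum_incident_block w j (p : point) :
  (\sum_c incident w (j, c) p
   = if p is inl a then (a == j) * 2 else 2)%N.
Proof.
rewrite sum_bool2; case: p => [a|[[|[|[|[|[|]]]]] //= ?]] /=; last first.
1-5: by case: w.
by case: eqP => _; case: w.
Qed.

Lemma sum_incident_point w B : (\sum_p incident w B p = 3)%N.
Proof.
case: B => j [s t]; rewrite big_sumType /=.
rewrite (bigD1 j) //= eqxx /= big1 => [|a /negbTE->//].
by rewrite !big_ord_recl big_ord0 /=; case: s t w => [] [] [].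
Qed.

Lemma vertex_degreeE w v : (\sum_u vertex_adj w v u)%N = vertex_degree v.
Proof.
rewrite !big_sumType; case: v => [B|[p|i]] /=.
- rewrite (big1 _ xpredT) // add0n.
  by rewrite -(big_sumType _ (fun=> true) (fun p => nat_of_bool (incident (w B.1) B p))) /=
    sum_incident_point big1_eq addn0.
- congr (_ + (_ + _))%N.
  + rewrite (eq_bigr (fun B => nat_of_bool (incident (w B.1) (B.1, B.2) p))) => [|[]//].
    rewrite -(pair_bigA _ (fun j c => nat_of_bool (incident (w j) (j, c) p))) /=.
    under eq_bigr do rewrite sum_incident_block.
    case: p => [a|t]; last by rewrite sum_nat_const card_ord mulnC.
    by rewrite (bigD1 a) //= eqxx big1 // => j /negbTE; rewrite eq_sym => ->.
  + rewrite -(big_sumType _ (fun=> true) (fun q => nat_of_bool (p != q))) /=.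
    rewrite sum_nat_bool -(eq_card (A := predC1 p)) => [|q]; last first.
      by rewrite !inE eq_sym.
    by rewrite cardC1 card_sum !card_ord; lia.
  (* By [pads_enough], every index up to [rank p] is that of a pad. *)
  + have le_rank : ((rank p).+1 <= m)%N by have := rank_lt p; lia.
    transitivity (\sum_(i < (rank p).+1) 1)%N; last by rewrite sum1_card card_ord.
    rewrite (big_ord_widen _ (fun=> 1%N) le_rank).
    by rewrite [RHS]big_mkcond; apply: eq_bigr => i _; rewrite ltnS; case: (_ <= _)%N.
- by rewrite !big1_eq add0n addn0 big_sumType.
Qed.

(** Blocks have degree 3 and pads at most [b + 5], points at least [b + 7]; since [2 <= 2 * b], the
    degree of a point strictly increases with its rank. *)
Lemma vertex_degree_point p v : (0 < b)%N ->
  vertex_degree v = vertex_degree (inr (inl p)) -> v = inr (inl p).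
Proof.
move=> b_gt0; case: v => [B|[q|i]] /=.
- by case: p => a; lia.
- move=> E; congr (inr (inl _)); apply: rank_inj; move: E.
  by case: p q => [a|t] [a'|t'] /=; [|have := ltn_ord a|have := ltn_ord a'|]; lia.
- have: (\sum_q (i <= rank q) <= b + 5)%N.
    rewrite (sum_nat_bool (fun q => i <= rank q)%N) (leq_trans (max_card _)) //.
    by rewrite card_sum !card_ord.
  by case: p => a /=; lia.
Qed.

(* Excluding neighbours of X' or Z' discards the points and the pads. *)
Definition bit_witness (w : {ffun 'I_b -> bool}) (j : 'I_b) (v : vertex) :=
  let adj_to p := vertex_adj w v (inr (inl p)) in
  [&& adj_to (inl j), adj_to (inr 1%:R), adj_to (inr 3%:R),
      ~~ adj_to (inr 0) & ~~ adj_to (inr 4%:R)].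

(** A block of cell [j] contains an even number of x_j, Y, Z if the bit is [false], an odd number if
    it is [true]; all three occur together only in the latter case. *)
Lemma bit_witnessP (w : {ffun 'I_b -> bool}) j :
  w j <-> exists v, bit_witness w j v.
Proof.
split=> [wj|[[[i [s t]]|[[a|k]|i]]]].
- by exists (inl (j, (false, false))); rewrite /bit_witness /= wj eqxx.
- rewrite /bit_witness /= => /and5P[/andP[/eqP<-]].
  by case: s; case: t; case: (w j).
- by rewrite /bit_witness /= !andbF.
- by rewrite /bit_witness /=; case: k => [[|[|[|[|[|]]]]] //= ?].
(* A pad joined to x_j is also joined to X', whose rank [b] is larger. *)
- rewrite /bit_witness /= => /and5P[le_ij _ _ /negP[]].
  by rewrite (leq_trans le_ij) // addn0 ltnW.
Qed.

(** * Transport to ['I_n]: cospectrality and non-isomorphism *)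

Variables (n : nat) (g : 'I_n -> vertex).
Hypothesis g_bij : bijective g.

Definition block_graph (w : {ffun 'I_b -> bool}) : sgraph n :=
  @SGraph n (fun x y => vertex_adj w (g x) (g y))
    (fun x y => vertex_adj_sym w (g x) (g y)) (fun x => vertex_adj_irr w (g x)).

Lemma degree_block_graph w x : degree (block_graph w) x = vertex_degree (g x).
Proof.
rewrite -(vertex_degreeE w) (reindex g) /=; last exact: onW_bij.
by rewrite sum_nat_bool /degree -cardsE; apply: eq_card => y; rewrite !inE.
Qed.

(** All cells whose bits differ are switched at once; the blocks of the other cells count as outside
    vertices. *)
Definition diff_cell (w w' : {ffun 'I_b -> bool}) (v : vertex) : option 'I_b :=
  if v is inl B then (if w B.1 != w' B.1 then Some B.1 else None) else None.

Lemma sum_diff_cell (w w' : {ffun 'I_b -> bool}) j (F : vertex -> nat) : w j != w' j ->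
  (\sum_(x | diff_cell w w' (g x) == Some j) F (g x)
   = \sum_c F (inl (j, c)))%N.
Proof.
move=> wj; rewrite -(reindex g (P := fun v => diff_cell w w' v == Some j)) /=;
  last exact: onW_bij.
rewrite big_sumType /= [X in (_ + X)%N]big_pred0 // addn0.
rewrite (eq_bigl (fun B : block => (B.1 == j) && true)) => [|[i c] /=]; last first.
  by rewrite andbT; case: (i =P j) => [->|ne_ij]; rewrite ?wj ?eqxx //;
    case: ifP => // _; apply/eqP => -[].
rewrite (eq_bigr (fun B => F (inl (B.1, B.2)))) => [|[]//].
by rewrite -(pair_big (pred1 j) xpredT (fun i c => F (inl (i, c)))) /= big_pred1_eq.
Qed.

Lemma block_graph_cospectral (R : rcfType) w w' :
  cospectral (normalized_laplacian R (block_graph w))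
             (normalized_laplacian R (block_graph w')).
Proof.
pose cell x := diff_cell w w' (g x).
apply: (@switch_cospectral R n _ cell).
- by move=> x y; rewrite /cell /=; case: (g x) (g y) => [B|//] [B'|].
- move=> x y; rewrite /cell /=.
  by case: (g x) (g y) => [B|[p|i]] [B'|[q|i']] //=; case: eqP => // ->.
- move=> x y; rewrite /cell.
  case Egx: (g x) => [[j c]|//] /=; case: ifP => //= wj _ Cy.
  rewrite -sum1dep_card (sum_diff_cell (fun=> 1%N) wj) sum_bool2.
  rewrite (sum_diff_cell (fun v => vertex_adj w v (g y)) wj).
  case: (g y) Cy => [B|[p|i]] _ /=; rewrite ?Egx /= ?big1_eq ?muln0 //.
  rewrite sum_incident_block.
  (* Opposite bits put the edge in exactly one of the two graphs, and 4 * 1 = 2 * 2; for x_a of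
     another cell both sides vanish. *)
  have -> : w' j = ~~ w j by case: (w j) (w' j) wj => [] [].
  case: c {Egx} => s t; case: p => [a|k] /=.
    by case: eqP => _; case: s; case: (w j).
  by rewrite addbN; case: (_ (+) _).
- by move=> x; rewrite !degree_block_graph.
- move=> x y; rewrite !degree_block_graph /cell.
  by case: (g x) (g y) => [B|//] [B'|] //=; case: ifP.
Qed.

(** The degree of a point is attained nowhere else, so the isomorphism fixes all points and carries
    witnesses to witnesses. *)
Lemma block_graph_iso_sub w w' j : (0 < b)%N ->
  isomorphic (block_graph w) (block_graph w') -> w j -> w' j.
Proof.
move=> b_gt0 [f f_bij f_adj]; have [g' gK g'K] := g_bij.
have f_deg x : vertex_degree (g (f x)) = vertex_degree (g x).
  by rewrite -(degree_block_graph w') (degree_iso _ f_bij f_adj) degree_block_graph.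
pose h v := g (f (g' v)).
have h_adj u v : vertex_adj w' (h u) (h v) = vertex_adj w u v.
  by have := f_adj (g' u) (g' v); rewrite /= !g'K.
have h_point p : h (inr (inl p)) = inr (inl p).
  by apply: vertex_degree_point => //; rewrite /h f_deg g'K.
have h_point_adj v p : vertex_adj w' (h v) (inr (inl p)) = vertex_adj w v (inr (inl p)).
  by rewrite -{1}h_point h_adj.
move=> /bit_witnessP[v vP]; apply/bit_witnessP; exists (h v).
by rewrite /bit_witness !h_point_adj.
Qed.

Lemma block_graph_inj w w' : (0 < b)%N ->
  isomorphic (block_graph w) (block_graph w') -> w = w'.
Proof.
move=> b_gt0 iso; apply/ffunP => j; apply/idP/idP.
  exact: block_graph_iso_sub iso.
exact/(block_graph_iso_sub b_gt0)/isomorphic_sym.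
Qed.

End Construction.

Theorem theorem5 (R : realType) :
  exists N : nat, forall n : nat, (N <= n)%N ->
  exists F : 'I_(2 ^ (n %/ 7)) -> sgraph n,
    (forall i j : 'I_(2 ^ (n %/ 7)), i <> j -> ~ isomorphic (F i) (F j)) /\
    (forall i j : 'I_(2 ^ (n %/ 7)),
       cospectral (normalized_laplacian R (F i)) (normalized_laplacian R (F j))).
Proof.
(* From 70 on, [b >= 10], so [n >= 7 * b >= 6 * b + 10], which leaves at least [b + 5] pads. *)
exists 70%N => n n_ge70; set b := (n %/ 7)%N; pose m := (n - 5 * b - 5)%N.
have b_ge10 : (10 <= b)%N by rewrite /b; lia.
have pads_enough : (b + 5 <= m)%N by rewrite /m /b; lia.
have card_vertex :
    #|{: 'I_b * (bool * bool) + (('I_b + 'I_5) + 'I_m)}| = n.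
  by rewrite !card_sum !card_prod !card_ord card_bool /m /b; lia.
have card_bits : #|{: {ffun 'I_b -> bool}}| = (2 ^ b)%N.
  by rewrite card_ffun card_bool card_ord.
pose g i := enum_val (cast_ord (esym card_vertex) i).
have g_bij : bijective g.
  by apply: bij_comp (enum_val_bij _) _; exists (cast_ord card_vertex) => i;
    rewrite ?cast_ordK ?cast_ordKV.
exists (fun i => block_graph g (enum_val (cast_ord (esym card_bits) i))); split.
  move=> i j ne_ij /(block_graph_inj pads_enough g_bij (leq_trans _ b_ge10)) E.
  by apply: ne_ij; apply/(@cast_ord_inj _ _ (esym card_bits))/enum_val_inj/E.
by move=> i j; apply: block_graph_cospectral.
Qed.
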